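(* Let $n>9$ be an integer, let $d=\lfloor\sqrt{n}\rfloor$ (hence $d\ge 3$), let $\Delta=n-d^2$, and let $m\ge0$ be an integer. Then $\alpha(n;m)\ge m\sqrt{n}$ holds whenever: (a) $\Delta$ is odd and $m\le \max\left(d(d-3),\ d(d-2)/\Delta\right)$, or (b) $\Delta>0$ is even and $m\le\max\left(d(d-3)/2,\ 2d^2/\Delta\right)$.
   Context: Work over the complex numbers. For integers $n\ge1$, $m\ge0$, fix $n$ general points of $\mathbf{P}^2$ (''general'' means in a suitable nonempty Zariski open set of $n$-tuples, which may depend on $n$ and $m$). $I(n;m)\subset \mathbf{C}[\mathbf{P}^2]$ is the homogeneous ideal generated by all forms having multiplicity at least $m$ at each of the $n$ points, and $\alpha(n;m)$ is the least degree $t$ such that the homogeneous component $I(n;m)_t$ is nonzero. *)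

(* Defs.v *)
From HB Require Import structures.
From mathcomp Require Import all_boot all_order all_algebra.
From mathcomp Require Import boolp reals complex mpoly.

Set Implicit Arguments.
Unset Strict Implicit.
Unset Printing Implicit Defensive.

Import Order.TTheory GRing.Theory Num.Theory.
Local Open Scope ring_scope.

(* Conventions.  A point of P^2 is given by homogeneous coordinates, i.e. by a
   nonzero row vector of length 3, and an n-tuple of points of P^2 by an n x 3
   matrix with nonzero rows.  For forms F, [mult_ge] does not depend on the
   scaling of the coordinates, hence neither does [alpha]. *)

Section Plane.
Variable K : fieldType.

(* Local equation of the form F at the point v, in the affine chart
   {x_i = v_i} (where v_i != 0): the two remaining coordinates are written
   x_j = v_j + y_k, so that the point becomes the origin of the (y_0, y_1)
   plane. *)
Definition local_eq (F : {mpoly K[3]}) (v : 'rV[K]_3) (i : 'I_3) :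
    {mpoly K[2]} :=
  F \mPo [tuple (v 0 j)%:MP + oapp (fun k : 'I_2 => 'X_k) 0 (unlift i j)
         | j < 3].

Definition order_ge (m : nat) (f : {mpoly K[2]}) : Prop :=
  forall mu : 'X_{1..2}, (mdeg mu < m)%N -> f@_mu = 0.

(* For a form, the order of vanishing does not depend on the chart containing the point;
   we quantify over all of them. *)
Definition mult_ge (m : nat) (F : {mpoly K[3]}) (v : 'rV[K]_3) : Prop :=
  forall i : 'I_3, v 0 i != 0 -> order_ge m (local_eq F v i).

Definition fat_form (n : nat) (P : 'M[K]_(n, 3)) (m : nat)
    (F : {mpoly K[3]}) : Prop :=
  (exists t : nat, F \is t.-homog) /\ forall i : 'I_n, mult_ge m F (row i P).

(* Membership in the ideal I(n; m) generated by the forms above. *)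
Definition fat_ideal (n : nat) (P : 'M[K]_(n, 3)) (m : nat)
    (F : {mpoly K[3]}) : Prop :=
  exists s : seq ({mpoly K[3]} * {mpoly K[3]}),
    (forall x, x \in s -> fat_form P m x.2) /\ F = \sum_(x <- s) x.1 * x.2.

Definition fat_component_neq0 (n : nat) (P : 'M[K]_(n, 3)) (m t : nat) : Prop :=
  exists F : {mpoly K[3]}, [/\ F \is t.-homog, fat_ideal P m F & F != 0].

Lemma order_geM a b (f g : {mpoly K[2]}) :
  order_ge a f -> order_ge b g -> order_ge (a + b) (f * g).
Proof.
move=> hf hg mu hmu; rewrite mcoeffM big1 // => k /eqP Ek.
have: (mdeg k.1 + mdeg k.2 < a + b)%N by rewrite -mdegD -Ek.
case: (ltnP (mdeg k.1) a) => [/hf -> _|ha]; first by rewrite mul0r.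
case: (ltnP (mdeg k.2) b) => [/hg -> _|hb]; first by rewrite mulr0.
by rewrite ltnNge leq_add.
Qed.

Definition line_through (v : 'rV[K]_3) : {mpoly K[3]} :=
  if v 0 0 == 0 then 'X_0 else v 0 1 *: 'X_0 - v 0 0 *: 'X_1.

Lemma line_throughP (v : 'rV[K]_3) :
  [/\ line_through v \is 1.-homog, line_through v != 0 &
      forall i, order_ge 1 (local_eq (line_through v) v i)].
Proof.
have X1 (i : 'I_3) : ('X_i : {mpoly K[3]}) \is 1.-homog.
  by rewrite dhomogX; apply/eqP; exact: mdeg1.
have U01 : (U_(0%R)%MM : 'X_{1..3}) != U_(1%R)%MM.
  by apply/eqP=> /mnmP /(_ ord0); rewrite !mnm1E.
split.
- rewrite /line_through; case: ifP => // _.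
  by rewrite rpredB // rpredZ.
- rewrite /line_through; case: ifP => [_|v0].
    by apply/eqP=> /(congr1 (mcoeff U_(0%R)%MM))/eqP;
       rewrite mcoeffX eqxx mcoeff0 oner_eq0.
  apply/eqP=> /(congr1 (mcoeff U_(1%R)%MM))/eqP.
  rewrite mcoeffB !mcoeffZ !mcoeffX eqxx (negPf U01) mcoeff0.
  by rewrite mulr0 mulr1 sub0r oppr_eq0 v0.
- move=> i mu; rewrite ltnS leqn0 mdeg_eq0 => /eqP ->.
  have y0 (o : option 'I_2) :
      (oapp (fun k : 'I_2 => 'X_k) (0 : {mpoly K[2]}) o)@_0%MM = 0.
    case: o => [k|] /=; last by rewrite mcoeff0.
    by rewrite mcoeffX; case: eqP => // /(congr1 mdeg); rewrite mdeg1 mdeg0.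
  have E (j : 'I_3) : (local_eq 'X_j v i)@_0%MM = v 0 j.
    by rewrite /local_eq comp_mpolyXU -tnth_nth tnth_mktuple mcoeffD y0
               mcoeffC eqxx mulr1 addr0.
  rewrite /line_through; case: ifP => [/eqP v0|_]; first by rewrite E.
  rewrite /local_eq comp_mpolyB !comp_mpolyZ mcoeffB !mcoeffZ.
  by rewrite -!/(local_eq _ _ _) !E mulrC subrr.
Qed.

Lemma order_ge_exp m (f : {mpoly K[2]}) : order_ge 1 f -> order_ge m (f ^+ m).
Proof.
by move=> hf; elim: m => [|m IH] // ; rewrite exprS -add1n; apply: order_geM.
Qed.

Lemma fat_component_exists (n : nat) (P : 'M[K]_(n, 3)) (m : nat) :
  exists t : nat, `[< fat_component_neq0 P m t >].
Proof.
pose l (i : 'I_n) := line_through (row i P) ^+ m.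
pose F := \prod_(i < n) l i.
have hF : exists t : nat, F \is t.-homog.
  rewrite /F; elim/big_ind: _ => [|p q [a ha] [b hb]|i _].
  - by exists 0%N; apply: dhomog1.
  - by exists (a + b)%N; apply: dhomogM.
  - exists (1 * m)%N; apply: dhomogMn.
    by case: (line_throughP (row i P)).
case: (hF) => t ht; exists t; apply/asboolP; exists F; split => //.
  exists [:: (1, F)]; split; last by rewrite big_seq1 mul1r.
  move=> x; rewrite inE => /eqP -> /=; split=> // i k _.
  rewrite /local_eq /F (bigD1 i) //= rmorphM rmorphXn /= -[m in order_ge m]addn0.
  apply: order_geM => //; apply: order_ge_exp.
  by case: (line_throughP (row i P)) => _ _; apply.
apply/prodf_neq0 => i _; rewrite expf_neq0 //.
by case: (line_throughP (row i P)).
Qed.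

Definition alpha (n : nat) (P : 'M[K]_(n, 3)) (m : nat) : nat :=
  ex_minn (fat_component_exists P m).

Definition point_tuple (n : nat) (P : 'M[K]_(n, 3)) : Prop :=
  forall i : 'I_n, row i P != 0.

(* Polynomials in the n * 3 homogeneous coordinates of (P^2)^n; the variable of
   index [mxvec_index i j] is the j-th coordinate of the i-th point.  [multihomog]
   asks for homogeneity in the coordinates of each point separately. *)
Definition multihomog (n : nat) (f : {mpoly K[n * 3]}) : Prop :=
  exists e : 'I_n -> nat, forall mu : 'X_{1..n * 3}, mu \in msupp f ->
    forall i : 'I_n, (\sum_(j < 3) mu (mxvec_index i j))%N = e i.

Definition eval_at (n : nat) (f : {mpoly K[n * 3]}) (P : 'M[K]_(n, 3)) : K :=
  f.@[fun k => mxvec P 0 k].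

Definition zariski_open (n : nat) (U : 'M[K]_(n, 3) -> Prop) : Prop :=
  exists S : {mpoly K[n * 3]} -> Prop,
    (forall f, S f -> multihomog f) /\
    (forall P, U P <->
       point_tuple P /\ exists f, S f /\ eval_at f P != 0).

Definition general_points (n : nat) (Q : 'M[K]_(n, 3) -> Prop) : Prop :=
  exists U : 'M[K]_(n, 3) -> Prop,
    [/\ zariski_open U, exists P, U P & forall P, U P -> Q P].

End Plane.

(* Main.v *)
Require Import Defs.
From HB Require Import structures.
From mathcomp Require Import all_boot all_order all_algebra.
From mathcomp Require Import boolp reals complex mpoly.
From mathcomp Require Import zify.

(** The points are specialized to points of the arc G : y = x^d + (x - 1)^r that
    all tend to (1, 1). A family of forms of degree t with multiplicity m at these
    points degenerates to a nonzero polynomial F such that, if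
    F = sum_b f_b(x) w^b with w = y - x^d - (x - 1)^r, then (x - 1)^(n (m - b))
    divides f_b.

    The arc has contact of order r with the rational curve C : y = x^d. If the weight
    n * m is replaced by S, then F restricted to C is a polynomial in x that vanishes
    at 1 to order at least min_b ((S - n b) + r b), while it involves only the monomials
    x^(a + d b) with a < d and a + b <= t. A nonzero polynomial with N terms vanishes
    at 1 to order less than N in characteristic 0, so F vanishes on C as soon as the
    order reaches the number of terms; dividing by y - x^d replaces t by t - d and
    S by S - r, and the descent continues until the degree is negative. Counting terms
    instead of degrees accounts for the genus of a smooth curve of degree d.

    With D = n - d^2, this works for r = floor (d sqrt n), that is
    r = d^2 + (D - 1) / 2 for odd D and r = d^2 + D / 2 - 1 for even D, except when D is
    even and m D <= 2 d^2, where one takes r = d^2 + D / 2. *)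

Set Implicit Arguments.
Unset Strict Implicit.
Unset Printing Implicit Defensive.

Import Order.TTheory GRing.Theory Num.Theory.
Local Open Scope ring_scope.

(** * Numerical estimates *)

(* The number of pairs (a, b) with a < d and a + b < T, hence of monomials
   available on the rational curve y = x^d in degree < T. *)
Definition term_count d T := (\sum_(a < d) (T - a))%N.

Lemma term_count_ge d T : (d <= T)%N ->
  (2 * term_count d T + d * d = 2 * d * T + d)%N.
Proof.
rewrite /term_count; elim: d => [|d IHd] dT; first by rewrite big_ord0; lia.
rewrite big_ord_recr /=; move: (IHd (ltnW dT)); move: (\sum_(_ < d) _) => s.
by nia.
Qed.

Lemma term_count_le d T : (T <= d)%N -> (2 * term_count d T = T * T.+1)%N.
Proof.
move=> /subnKC <-; elim: (d - T)%N => [|e IHe].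
  by rewrite addn0; have := @term_count_ge T T (leqnn _); nia.
rewrite addnS /term_count big_ord_recr /= -[X in (X - _)%N]addn0 subnDl addn0; exact: IHe.
Qed.

Lemma term_count_bound d T : (0 < d)%N -> (term_count d T.+1 <= d * T + 1)%N.
Proof.
move=> d0; case: (leqP d T.+1) => h; first by have := term_count_ge h; nia.
have := term_count_le (ltnW h); nia.
Qed.

Section Below.
Variables n d r m t k b : nat.
Hypotheses (d3 : (3 <= d)%N) (dr : (d * d <= r)%N) (rn : (r <= n)%N)
  (rd : (r * r <= n * (d * d))%N) (nd : (n < d.+1 * d.+1)%N)
  (tm : (t * t < m * m * n)%N) (tdr : (2 * (t * d) <= 2 * (m * r) + d * (d - 3))%N)
  (kt : (k * d <= t)%N).

(** Case r <= d sqrt n. Put S = n m - k r and u = t - k d. The right side is at least r S / n for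
    every b; [tdr] makes this large enough when u + 1 >= d, and [tm] with [nd] settles smaller u. *)
Lemma term_count_below :
  (term_count d (t.+1 - k * d) <= (n * m - k * r - n * b) + r * b)%N.
Proof.
have [u Et] : exists u, t = (k * d + u)%N by exists (t - k * d)%N; rewrite subnKC.
have n0 : (0 < n)%N by nia.
have krn : (k * r < n * m)%N.
  rewrite -(ltn_sqr (k * r)) !expnS !expn0 !muln1.
  have h1 : (k * r * (k * r) <= n * (t * t))%N.
    apply: (@leq_trans (n * ((k * d) * (k * d)))).
      by have := leq_mul (leqnn (k * k)) rd; lia.
    by have := leq_mul (leqnn n) (leq_mul kt kt); lia.
  apply: leq_ltn_trans h1 _.
  by move: tm; rewrite -(ltn_pmul2l n0); lia.
have [S ES] : exists S, (n * m = k * r + S)%N by exists (n * m - k * r)%N; rewrite subnKC // ltnW.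
have S0 : (0 < S)%N by lia.
rewrite {1}ES addKn.
have -> : (t.+1 - k * d = u.+1)%N by rewrite Et; lia.
set M := (_ - _ + _)%N.
(* In b the right side has slope r - n <= 0 up to b = S / n and slope r after it, so its real
   minimum is r S / n. *)
have hM : (r * S <= n * M)%N.
  rewrite /M; case: (leqP (n * b) S) => h.
    have [w Ew] : exists w, S = (n * b + w)%N by exists (S - n * b)%N; rewrite subnKC.
    by rewrite Ew addKn; nia.
  by rewrite (eqP (ltnW h)) add0n; nia.
clearbody M.
case: (leqP d u.+1) => hu.
  have hN := term_count_ge hu; move: (term_count d u.+1) hN => N hN.
  have dd : (d * (d - 3) + 3 * d = d * d)%N by nia.
  have hN' : (2 * N + d * (d - 3) = 2 * (d * u))%N by nia.
  (* Now r S / n = m r - k r^2 / n >= m r - k d^2 while N = d t - k d^2 - d (d - 3) / 2, so [tdr]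
     suffices. *)
  rewrite -(leq_pmul2l n0) (leq_trans _ hM) //.
  have h1 : (k * (r * r) <= k * (n * (d * d)))%N by rewrite leq_mul2l rd orbT.
  have h2 : (n * (2 * (t * d)) <= n * (2 * (m * r) + d * (d - 3)))%N by rewrite leq_mul2l tdr orbT.
  have h3 : (n * (2 * N + d * (d - 3)) = n * (2 * (d * u)))%N by rewrite hN'.
  have h4 : (r * (n * m) = r * (k * r + S))%N by rewrite ES.
  rewrite Et in h2; nia.
have hN := term_count_le (ltnW hu); move: (term_count d u.+1) hN => N hN.
(* Otherwise S <= u sqrt n; adding k r <= k d sqrt n gives n m <= t sqrt n, against [tm]. *)
have hS : (n * (u * u) < S * S)%N.
  rewrite ltnNge; apply/negP => hS.
  have h1 : (k * r * (k * r) <= n * (k * d * (k * d)))%N.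
    by have := leq_mul (leqnn (k * k)) rd; lia.
  have h2 : (S * (k * r) <= n * (u * (k * d)))%N.
    rewrite -leq_sqr !expnS !expn0 !muln1 mulnACA.
    apply: leq_trans (leq_mul hS h1) _.
    by lia.
  have h3 : (n * m * (n * m) <= n * (t * t))%N by rewrite ES Et; nia.
  by move: tm; rewrite -(ltn_pmul2l n0); lia.
(* M >= r S / n > r u / sqrt n >= d^2 u / sqrt n, and (d - 1) sqrt n <= (d - 1) (d + 1) < d^2. *)
have hM2 : ((d - 1) * u < M)%N.
  rewrite ltnNge; apply/negP => h.
  have r0 : (0 < r)%N by nia.
  have h1 : (r * r * (n * (u * u)) < n * M * (n * M))%N.
    apply: leq_trans (leq_mul hM hM); rewrite [(r * S * _)%N]mulnACA.
    by rewrite ltn_pmul2l ?muln_gt0 ?r0.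
  have h2 : (r * r * (u * u) < n * (M * M))%N.
    by rewrite -(ltn_pmul2l n0); lia.
  have h3 : (n * (M * M) <= n * ((d - 1) * u * ((d - 1) * u)))%N.
    by have := leq_mul (leqnn n) (leq_mul h h); lia.
  have h4 : (n * ((d - 1) * (d - 1)) <= d * d * (d * d))%N.
    have [c Ec] : exists c, d = c.+1 by exists d.-1; lia.
    have : (n <= c.+2 * c.+2)%N by rewrite -Ec ltnW.
    rewrite Ec subn1 /= => h5.
    by apply: leq_trans (leq_mul h5 (leqnn _)) _; rewrite mulnACA leq_mul //; nia.
  have h5 : (d * d * (d * d) <= r * r)%N by rewrite leq_mul.
  have h6 : (n * ((d - 1) * (d - 1)) * (u * u) <= r * r * (u * u))%N.
    by rewrite leq_mul2r (leq_trans h4 h5) orbT.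
  move: h2; rewrite ltnNge (leq_trans h3) // [((d - 1) * u * _)%N]mulnACA mulnA; exact: h6.
have : (u.+1 * u.+2 <= 2 * ((d - 1) * u + 1))%N.
  have [c Ec] : exists c, d = (u + 2 + c)%N by exists (d - (u + 2))%N; lia.
  have -> : (d - 1 = u + 1 + c)%N by lia.
  by clear; nia.
lia.
Qed.
End Below.

(** Here r is the mean of d^2 and n, and the weight left after k divisions is n (m - k) + k e. At
    least r (m - k) + k e is needed: this is clear for b <= m - k, and for larger b it follows from
    k e <= m e <= d^2 <= r. *)
Lemma term_count_above n d r e m t k b : (0 < d)%N ->
  n = (d * d + 2 * e)%N -> r = (d * d + e)%N -> (t * d < m * r)%N ->
  (m * e <= d * d)%N -> (k * d <= t)%N ->
  (term_count d (t.+1 - k * d) <= (n * m - k * r - n * b) + r * b)%N.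
Proof.
move=> d0 En Er td me kt.
have [u Et] : exists u, t = (k * d + u)%N by exists (t - k * d)%N; rewrite subnKC.
have km : (k <= m)%N.
  rewrite -ltnS -(@ltn_pmul2r (d * d)) ?muln_gt0 ?d0 //.
  by apply: (@leq_ltn_trans (t * d)); [rewrite mulnA leq_mul2r kt orbT|nia].
have [l Em] : exists l, m = (k + l)%N by exists (m - k)%N; rewrite subnKC.
have -> : (t.+1 - k * d = u.+1)%N by rewrite Et; lia.
apply: leq_trans (term_count_bound _ d0) _.
have ES : (n * m - k * r = n * l + k * e)%N by rewrite En Er Em; nia.
rewrite ES.
have hu : (d * u < r * l + k * e)%N by rewrite Et Er Em in td; nia.
rewrite addn1; apply: (leq_trans hu).
case: (leqP b l) => hb.
  have [c Ec] : exists c, l = (b + c)%N by exists (l - b)%N; rewrite subnKC.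
  have -> : (n * l + k * e - n * b = n * c + k * e)%N by rewrite Ec; nia.
  have : (r * c <= n * c)%N by rewrite leq_mul2r En Er; lia.
  by rewrite Ec; nia.
apply: leq_trans (leq_addl _ _).
have : (k * e <= r)%N by rewrite Er; nia.
nia.
Qed.

Lemma exists_contact_order n d D m t : (9 < n)%N -> (d * d <= n)%N ->
  (n < d.+1 * d.+1)%N -> n = (d * d + D)%N ->
  (odd D /\ (m <= d * (d - 3) \/ m * D <= d * (d - 2)))%N \/
  (0 < D /\ ~~ odd D /\ (2 * m <= d * (d - 3) \/ m * D <= 2 * (d * d)))%N ->
  (t * t < m * m * n)%N ->
  exists2 r, (r <= n)%N & forall k b, (k * d < t.+1)%N ->
    (term_count d (t.+1 - k * d) <= (n * m - k * r - n * b) + r * b)%N.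
Proof.
move=> n9 dn nd En hm tm.
have d3 : (3 <= d)%N by nia.
have D2 : (D <= 2 * d)%N by nia.
(* By the inequality of means, d sqrt n <= (d^2 + n) / 2 = d^2 + D / 2. *)
have tmd : (2 * (t * d) < m * (2 * (d * d) + D))%N.
  rewrite -ltn_sqr !expnS !expn0 !muln1.
  have h : (4 * (d * d) * (t * t) < 4 * (d * d) * (m * m * n))%N.
    by rewrite ltn_pmul2l ?muln_gt0 //; lia.
  apply: (@leq_trans (4 * (d * d) * (m * m * n))); first by lia.
  have -> : (4 * (d * d) * (m * m * n) = m * m * (4 * (d * d) * n))%N by lia.
  rewrite [X in (_ <= X)%N]mulnACA leq_mul2l; apply/orP; right.
  rewrite En; nia.
case: hm => [[oD hm]|[D0 [eD hm]]].
  have [e ED] : exists e, D = (2 * e + 1)%N by exists D./2; lia.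
  exists (d * d + e)%N; first by lia.
  move=> k b kt; apply: term_count_below => //; try lia.
    have ee : (e * e <= d * d)%N by apply: leq_mul; lia.
    by rewrite En ED; lia.
  case: hm => hm; first by rewrite ED in tmd; move: (d * (d - 3))%N hm => w; lia.
  have me0 := leq0n (m * e).
  case: (leqP t (m * d)) => htm; first by have := leq_mul htm (leqnn d); lia.
  have [j Ej] : exists j, t = (m * d + j)%N by exists (t - m * d)%N; rewrite subnKC // ltnW.
  (* Expand (m d + j)^2 < m^2 (d^2 + D) and drop j^2. With m D <= d (d - 2) this gives 2 j < d - 2,
     and integrality improves it to 2 j <= d - 3. *)
  have hj : (2 * (d * j) < m * D)%N.
    rewrite Ej En in tm; have m0 : (0 < m)%N by case: (m) tm.
    by rewrite -(ltn_pmul2l m0); have := leq0n (j * j); lia.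
  have hj2 : (2 * j < d - 2)%N by rewrite -(@ltn_pmul2l d); lia.
  have hj3 : (d * (2 * j) <= d * (d - 3))%N by rewrite leq_mul2l; lia.
  by rewrite Ej; lia.
have [e ED] : exists e, D = (2 * e)%N by exists D./2; lia.
case: hm => hm.
  have [f Ef] : exists f, e = f.+1 by exists e.-1; lia.
  (* For this r, [tmd] reads 2 t d < 2 m r + 2 m, and 2 m <= d (d - 3). *)
  exists (d * d + f)%N; first by lia.
  move=> k b kt; apply: term_count_below => //; try lia.
    have ff : (f * f <= d * d)%N by apply: leq_mul; lia.
    by rewrite En ED Ef; lia.
exists (d * d + e)%N; first by lia.
move=> k b kt; apply: (@term_count_above _ _ _ e) => //; lia.
Qed.

(** * Descent along the rational curve *)

Lemma natr_inj_pchar0 (K : fieldType) :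
  [pchar K] =i pred0 -> injective (fun i : nat => i%:R : K).
Proof.
move=> char0 i j /= E.
wlog ij : i j E / (i < j)%N.
  by move=> W; case: (ltngtP i j) => h //; [apply: W|apply/esym/W].
have := (pcharf0P _).1 char0 (j - i)%N; rewrite natrB ?(ltnW ij) // E subrr eqxx.
by move/esym; rewrite subn_eq0 leqNgt ij.
Qed.

Section Descent.
Variable K : fieldType.
Hypothesis char0 : [pchar K] =i pred0.

Lemma dvdp_exp_deriv (q p : {poly K}) M : q ^+ M.+1 %| p -> q ^+ M %| p^`().
Proof.
move=> /dvdpP[u ->]; rewrite derivM deriv_exp /= dvdp_add //.
  by rewrite exprSr mulrA dvdp_mulr // dvdp_mull.
by rewrite -mulrnAl mulrA dvdp_mull.
Qed.

(* The Euler-type operator [p |-> 'X * p' - e p] kills ['X^e] and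
   loses at most one order of vanishing at 1. *)
Lemma few_terms_eq0 (s : seq nat) M (p : {poly K}) :
  (size s <= M)%N -> (forall j, j \notin s -> p`_j = 0) ->
  ('X - 1%:P) ^+ M %| p -> p = 0.
Proof.
elim: s M p => [|e s IHs] M p hs hp; first by move=> _; apply/polyP=> j; rewrite hp ?coef0.
case: M hs => // M; rewrite ltnS => hs hdvd.
pose q := 'X * p^`() - e%:R *: p.
have Eq j : q`_j = (j%:R - e%:R) * p`_j.
  rewrite coefB coefZ coefXM mulrBl; congr (_ - _).
  by case: j => [|j] /=; rewrite ?mul0r // coef_deriv mulr_natl.
have q0 : q = 0.
  apply: (IHs M) => // [j hj|].
    rewrite Eq; have [->|ne] := eqVneq j e; first by rewrite subrr mul0r.
    by rewrite hp ?mulr0 // inE negb_or ne.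
  rewrite dvdp_sub ?dvdp_mull ?dvdp_exp_deriv //.
  by rewrite -mul_polyC dvdp_mull // (dvdp_trans _ hdvd) // dvdp_exp2l.
(* In characteristic 0 the operator kills only multiples of ['X^e], whose value at 1 is their
   coefficient. *)
have Ep : p = p`_e *: 'X^e.
  apply/polyP=> j; rewrite coefZ coefXn; have [->|ne] := eqVneq j e; first by rewrite mulr1.
  rewrite mulr0; have /eqP := Eq j; rewrite q0 coef0 eq_sym mulf_eq0 => /orP[|/eqP //].
  by rewrite subr_eq0 => /eqP/(natr_inj_pchar0 char0) Ej; rewrite Ej eqxx in ne.
have : root p 1.
  rewrite -dvdp_XsubCl (dvdp_trans _ hdvd) // exprS dvdp_mulr //.
by rewrite rootE Ep hornerZ hornerXn expr1n mulr1 => /eqP ->; rewrite scale0r.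
Qed.

Definition tdeg_lt T (F : {poly {poly K}}) := forall b, (size (F`_b)%R <= T - b)%N.

Lemma tdeg_lt0 F : tdeg_lt 0 F -> F = 0.
Proof.
move=> hF; apply/polyP=> b; rewrite coef0; apply/eqP.
by rewrite -size_poly_leq0; apply: leq_trans (hF b) _; rewrite sub0n.
Qed.

(** Writing i = a + d c with a < d, the monomial x^i y^b restricts to x^(a + d (b + c)), and a + b +
    c <= i + b < T. So at most [term_count d T] exponents occur. *)
Lemma restrict_vanish d T M F : (0 < d)%N -> tdeg_lt T F ->
  (term_count d T <= M)%N -> ('X - 1%:P) ^+ M %| F.['X^d] -> F.['X^d] = 0.
Proof.
move=> d0 hF hM; pose s := [seq (a + d * b)%N | a <- iota 0 d, b <- iota 0 (T - a)].
apply: (@few_terms_eq0 s).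
  rewrite size_allpairs_dep (leq_trans _ hM) // /term_count.
  rewrite sumnE big_map -(big_mkord xpredT (fun a => T - a)%N) /index_iota subn0.
  by apply: leq_sum => a _; rewrite size_iota.
move=> j hj; rewrite horner_coef coef_sum big1 // => -[b hb] _ /=.
rewrite -exprM coefMXn; case: ltnP => // hbj.
apply: nth_default; rewrite leqNgt; apply: contra hj => hlt.
have := leq_trans hlt (hF b) => hab.
apply/allpairsPdep; exists (j %% d)%N, (j %/ d)%N; rewrite !mem_iota /= !add0n.
have E := divn_eq j d; have l := ltn_pmod j d0; split => //; last by nia.
have hb' : (b <= j %/ d)%N by rewrite leq_divRL // mulnC.
nia.
Qed.

Definition curve d : {poly {poly K}} := 'X - ('X^d)%:P.
Definition arc d r : {poly K} := 'X^d + ('X - 1%:P) ^+ r.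
(** Weighted order at least S at x = 1, w = y - g(x) = 0, where x - 1 has weight 1 and w has weight
    n. *)
Definition arc_order n S g (F : {poly {poly K}}) :=
  forall b, ('X - 1%:P) ^+ (S - n * b) %| (F \Po ('X + g%:P))`_b.

Lemma coef_mul_curve d (q : {poly {poly K}}) b :
  (q * curve d)`_b = (if b == 0%N then 0 else q`_b.-1) - 'X^d * q`_b.
Proof. by rewrite mulrBr coefB coefMX coefMC mulrC. Qed.

(** Induction on b: the coefficient of y^b gives x^d q_b = q_(b-1) - (q * curve)_b. *)
Lemma tdeg_lt_div d T q : (0 < d)%N ->
  tdeg_lt T (q * curve d) -> tdeg_lt (T - d) q.
Proof.
move=> d0 h; elim=> [|b IHb].
  have := h 0%N; rewrite coef_mul_curve eqxx sub0r size_opp.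
  have [->|nz] := eqVneq q`_0 0; first by rewrite size_poly0.
  rewrite size_monicM ?monicXn // size_polyXn /= => h2; rewrite ?subn0; move: (size _) h2 => s h2; lia.
have [->|nz] := eqVneq q`_b.+1 0; first by rewrite size_poly0.
have := h b.+1; rewrite coef_mul_curve /= => h1.
have : (size (('X^d * q`_b.+1)%R) <= T - b.+1)%N.
  rewrite -[_ * _](subKr q`_b) (leq_trans (size_polyD _ _)) // geq_max size_opp h1 andbT.
  by apply: leq_trans IHb _; lia.
rewrite size_monicM ?monicXn // size_polyXn /= => h2; rewrite ?subn0; move: (size _) h2 => s h2; lia.
Qed.

(** In the coordinates x, w the curve is w + (x - 1)^r. Induction on b, where r <= n makes the bound
    for [Q]_(b-1) strong enough for [Q]_b. *)
Lemma arc_order_div n S d r q : (r <= n)%N ->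
  arc_order n S (arc d r) (q * curve d) -> arc_order n (S - r) (arc d r) q.
Proof.
move=> rn h; pose L : {poly K} := 'X - 1%:P.
have L0 : L != 0 by rewrite polyXsubC_eq0.
have cL k (u : {poly K}) e : L ^+ e %| L ^+ k * u -> L ^+ (e - k) %| u.
  case: (leqP k e) => [ke|/ltnW ek _]; last by rewrite (eqP ek) expr0 dvd1p.
  by rewrite -{1}(subnKC ke) exprD dvdp_mul2l // expf_neq0.
set Q := q \Po ('X + (arc d r)%:P).
have E b : L ^+ r * Q`_b =
    ((q * curve d) \Po ('X + (arc d r)%:P))`_b - (if b == 0%N then 0 else Q`_b.-1).
  rewrite comp_polyM /curve comp_polyB comp_polyX comp_polyC.
  have Ea : arc d r - 'X^d = L ^+ r by rewrite /arc addrAC subrr add0r.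
  rewrite -addrA -polyCB Ea -/Q.
  by rewrite mulrDr coefD coefMX coefMC addrAC subrr add0r mulrC.
elim=> [|b IHb]; rewrite -/L -/Q.
  rewrite subnAC; apply: cL; rewrite E eqxx subr0; exact: h.
rewrite subnAC; apply: cL; rewrite E dvdp_sub ?h //=.
by apply: dvdp_trans IHb; rewrite dvdp_exp2l //; lia.
Qed.

(** On the curve w = - (x - 1)^r, so w^b contributes r b to the order. *)
Lemma restrict_order n S d r M F : arc_order n S (arc d r) F ->
  (forall b, M <= (S - n * b) + r * b)%N -> ('X - 1%:P) ^+ M %| F.['X^d].
Proof.
move=> h hM.
have -> : F.['X^d] = (F \Po ('X + (arc d r)%:P)).[- ('X - 1%:P) ^+ r].
  by rewrite horner_comp hornerD hornerX hornerC /arc addrC addrK.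
rewrite horner_coef; elim/big_rec: _ => [|b p _ hp]; first exact: dvdp0.
rewrite dvdp_add // exprNn mulrCA dvdp_mull // -exprM.
apply: dvdp_trans (dvdp_exp2l _ (hM b)) _.
by rewrite exprD dvdp_mul.
Qed.

Lemma arc_order_eq0 n d r T S F : (0 < d)%N -> (r <= n)%N ->
  (forall k b, k * d < T ->
     term_count d (T - k * d) <= (S - k * r - n * b) + r * b)%N ->
  tdeg_lt T F -> arc_order n S (arc d r) F -> F = 0.
Proof.
move=> d0 rn; have [N] := ubnP T; elim: N => // N IHN in T S F *.
rewrite ltnS => TN hc hF hS; have [T0|T0] := posnP T.
  by apply: tdeg_lt0; rewrite -T0.
have FC : root F 'X^d.
  apply/eqP; apply: (restrict_vanish d0 hF (leqnn _)).
  apply: restrict_order hS _ => b; have := hc 0%N b.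
  by rewrite !mul0n !subn0; apply.
have /factor_theorem[q Eq] := FC.
have {}Eq : F = q * curve d by [].
rewrite Eq in hF hS *; rewrite (IHN (T - d)%N (S - r)%N q) ?mul0r //.
- lia.
- move=> k b hk; have := hc k.+1 b; rewrite !mulSn !subnDA; apply; lia.
- exact: tdeg_lt_div.
- exact: arc_order_div.
Qed.
End Descent.

(** * Minors of matrices over an integral domain *)

Lemma fraction_numden (R : idomainType) (x : {fraction R}) :
  exists a : R * R, a.1 != 0 /\ tofrac a.1 * x = tofrac a.2.
Proof.
elim/quotW: x => -[[u v] /= v0]; exists (v, u); split => //=.
unlock tofrac; rewrite -[LHS]FracField.pi_mul; apply/eqmodP.
by rewrite /= FracField.equivfE /FracField.mulf !numden_Ratio ?oner_eq0 //= ?mul1r ?mulr1 // mulrC.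
Qed.

Section Minor.
Variables (R : idomainType) (I J : finType) (A : I -> J -> R).

Definition minor (f : 'I_#|I| -> J) := \det (\matrix_(k, l) A (enum_val k) (f l)).

Lemma minor_neq0_ker f u : minor f != 0 ->
  (forall j, \sum_i u i * A i j = 0) -> forall i, u i = 0.
Proof.
move=> hf hu i; apply/eqP; apply: contraNT hf => ui.
apply/det0P; exists (\row_k u (enum_val k)).
  apply/negP => /eqP/rowP/(_ (enum_rank i)); rewrite !mxE enum_rankK => /eqP.
  by rewrite (negPf ui).
apply/rowP=> l; rewrite !mxE -[RHS](hu (f l)).
rewrite (reindex (@enum_val I predT)) /=; first by apply: eq_bigr => k _; rewrite !mxE.
by exists enum_rank => k _; rewrite ?enum_valK ?enum_rankK.
Qed.

(** Multiplying a left kernel vector over the fraction field by the product c of its denominators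
    gives one over [R]. Hence the rows are independent over the field, and a column basis gives the
    minor. *)
Lemma exists_minor_neq0 :
  (forall u, (forall j, \sum_i u i * A i j = 0) -> forall i, u i = 0) ->
  exists f, minor f != 0.
Proof.
move=> hA.
pose B : 'M[{fraction R}]_(#|I|, #|J|) := \matrix_(k, l) tofrac (A (enum_val k) (enum_val l)).
have : row_free B.
  apply: inj_row_free => v vB.
  have [a ha] := fin_all_exists (fun k => fraction_numden (v 0 k)).
  pose c := \prod_k (a k).1.
  have c0 : c != 0 by apply/prodf_neq0 => k _; case: (ha k).
  pose u i := (\prod_(k | k != enum_rank i) (a k).1) * (a (enum_rank i)).2.
  have Eu i : tofrac (u i) = tofrac c * v 0 (enum_rank i).
    rewrite /u /c [in RHS](bigD1 (enum_rank i)) //= !tofracM -(ha _).2.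
    by rewrite mulrA [X in _ = X * _]mulrC.
  have u0 : forall i, u i = 0.
    apply: hA => j; apply/eqP; rewrite -tofrac_eq0; apply/eqP.
    have /rowP/(_ (enum_rank j)) := vB; rewrite !mxE => /(congr1 ( *%R (tofrac c))).
    rewrite mulr0 mulr_sumr => E; rewrite rmorph_sum -[RHS]E.
    rewrite [LHS](reindex (@enum_val I predT)) /=; last first.
      by exists enum_rank => k _; rewrite ?enum_valK ?enum_rankK.
    by apply: eq_bigr => k _; rewrite !mxE tofracM Eu enum_valK enum_rankK mulrA.
  apply/rowP=> k; rewrite mxE; apply/eqP; have /eqP := Eu (enum_val k).
  rewrite u0 tofrac0 enum_valK eq_sym mulf_eq0 tofrac_eq0 (negPf c0) //.
rewrite /row_free -mxrank_tr -[_ == _]/(row_full B^T) => hB.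
pose f l := enum_val (fullrankfun hB l); exists f.
have := fullrowsub_unit hB; rewrite unitmxE unitfE; apply: contraNN.
rewrite -tofrac_eq0 => /eqP hf.
rewrite -det_tr -{}hf /minor -det_map_mx; apply/eqP; congr (\det _).
by apply/matrixP=> k l; rewrite !mxE.
Qed.
End Minor.

(** * Degeneration to an arc *)

(** [tri T] indexes the monomials of degree below T, and [tri m] the conditions that multiplicity m
    imposes at one point. *)
Definition tri T := {x : 'I_T * 'I_T | (x.1 + x.2 < T)%N}.
Definition tri_x T (x : tri T) : nat := (val x).1.
Definition tri_y T (x : tri T) : nat := (val x).2.

Lemma tri_lt T (x : tri T) : (tri_x x + tri_y x < T)%N.
Proof. exact: (valP x). Qed.

Lemma tri_inj T (x y : tri T) : tri_x x = tri_x y -> tri_y x = tri_y y -> x = y.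
Proof.
case: x y => [[a b] hx] [[c e] hy]; rewrite /tri_x /tri_y /= => /val_inj ac /val_inj be.
by apply: val_inj; rewrite /= ac be.
Qed.

Lemma tri_ex T a b : (a + b < T)%N -> exists x : tri T, tri_x x = a /\ tri_y x = b.
Proof.
move=> h; have ha : (a < T)%N := leq_ltn_trans (leq_addr _ _) h.
have hb : (b < T)%N := leq_ltn_trans (leq_addl _ _) h.
by exists (@exist _ _ (Ordinal ha, Ordinal hb) h).
Qed.

(* Coefficient of x^a y^b in (x + x0)^p (y + y0)^q. *)
Definition taylor (R : comNzRingType) (x0 y0 : R) p q a b : R :=
  (x0 ^+ (p - a) *+ 'C(p, a)) * (y0 ^+ (q - b) *+ 'C(q, b)).

Lemma rmorph_taylor (R S : comNzRingType) (f : {rmorphism R -> S}) x0 y0 p q a b :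
  f (taylor x0 y0 p q a b) = taylor (f x0) (f y0) p q a b.
Proof. by rewrite rmorphM !rmorphMn !rmorphXn. Qed.

Lemma coef_XaddC_exp (R : comNzRingType) (c : R) k b :
  (('X + c%:P) ^+ k)`_b = c ^+ (k - b) *+ 'C(k, b).
Proof.
rewrite addrC exprDn coef_sum.
have E (i : 'I_k.+1) : (c%:P ^+ (k - i) * 'X^i *+ 'C(k, i))`_b =
    (if b == i :> nat then c ^+ (k - b) *+ 'C(k, b) else 0).
  rewrite coefMn -polyC_exp coefCM coefXn; case: eqP => [->|_].
    by rewrite mulr1.
  by rewrite mulr0 mul0rn.
rewrite (eq_bigr _ (fun i _ => E i)); case: (ltnP b k.+1) => hb.
  rewrite (bigD1 (Ordinal hb)) //= eqxx big1 ?addr0 // => i ne.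
  by case: eqP => // e; case/eqP: ne; apply: val_inj.
by rewrite bin_small // mulr0n big1 // => i _; case: ifP.
Qed.

Section Bivariate.
Variable R : comNzRingType.
Implicit Types F : {poly {poly R}}.

Definition bipoly T (u : tri T -> R) : {poly {poly R}} :=
  \sum_x (u x *: 'X^(tri_x x))%:P * 'X^(tri_y x).

Definition shift_x (c : R) F := map_poly (comp_poly ('X + c%:P)) F.

Definition shift x0 y0 F := shift_x x0 F \Po ('X + (y0%:P)%:P).

Lemma coef_shift_bipoly T (u : tri T -> R) x0 y0 a b :
  (shift x0 y0 (bipoly u))`_b`_a = \sum_x u x * taylor x0 y0 (tri_x x) (tri_y x) a b.
Proof.
rewrite /shift /shift_x /bipoly !rmorph_sum /= coef_sum coef_sum.
apply: eq_bigr => x _.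
rewrite !rmorphM /= map_polyC /= map_polyXn comp_polyC comp_Xn_poly.
rewrite coefCM coef_XaddC_exp comp_polyZ comp_Xn_poly -polyC_exp -polyCMn.
by rewrite coefMC coefZ coef_XaddC_exp /taylor mulrA.
Qed.

Lemma coef_bipoly T u (x : tri T) : (bipoly u)`_(tri_y x)`_(tri_x x) = u x.
Proof.
rewrite /bipoly !coef_sum (bigD1 x) //= big1 ?addr0 => [|y ne].
  by rewrite coefCM coefXn eqxx mulr1 coefZ coefXn eqxx mulr1.
rewrite coefCM coefXn; case: eqP => [e1|]; last by rewrite mulr0 coef0.
rewrite mulr1 coefZ coefXn; case: eqP => [e2|]; last by rewrite mulr0.
by case/eqP: ne; apply: tri_inj.
Qed.

Lemma size_bipoly T (u : tri T -> R) b : (size ((bipoly u)`_b)%R <= T - b)%N.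
Proof.
rewrite /bipoly coef_sum (leq_trans (size_sum _ _ _)) //.
apply/bigmax_leqP => x _; rewrite coefCM coefXn.
case: eqP => [->|]; last by rewrite mulr0 size_poly0.
rewrite mulr1 (leq_trans (size_scale_leq _ _)) // size_polyXn.
by rewrite ltn_subRL addnC tri_lt.
Qed.

Lemma dvdXnP k (p : {poly R}) :
  (forall a, (a < k)%N -> p`_a = 0) <-> exists q, p = q * 'X^k.
Proof.
split=> [h|[q ->] a ak]; last by rewrite coefMXn ak.
exists (drop_poly k p); rewrite -{1}[p](poly_take_drop k).
suff -> : take_poly k p = 0 by rewrite add0r.
by apply/polyP=> a; rewrite coef_take_poly coef0; case: ifP => // /h.
Qed.

(* Multiplicity m at the point (x0, g(x0)) of the arc y = g(x), read
   in the coordinates (x, y - g(x)). *)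
Lemma dvd_coef_arc m x0 (g : {poly R}) F b :
  (forall p q, (p + q < m)%N -> (shift x0 g.[x0] F)`_q`_p = 0) ->
  exists h, (F \Po ('X + g%:P))`_b = h * ('X - x0%:P) ^+ (m - b).
Proof.
move=> hF; pose tau : {rmorphism {poly R} -> {poly R}} := comp_poly ('X + x0%:P).
have [e Ee] : exists e, tau g = g.[x0]%:P + e * 'X.
  have /dvdXnP[e Ee] : forall a, (a < 1)%N -> (tau g - g.[x0]%:P)`_a = 0.
    move=> a; rewrite ltnS leqn0 => /eqP ->.
    by rewrite coefB coefC /= -horner_coef0 horner_comp !hornerE subrr.
  by exists e; rewrite -(expr1 'X) -Ee addrC subrK.
have E1 : map_poly tau (F \Po ('X + g%:P)) =
    shift x0 g.[x0] F \Po ('X + (e * 'X)%:P).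
  rewrite map_comp_poly rmorphD /= map_polyX map_polyC /= -/(tau g) Ee.
  rewrite /shift -comp_polyA; congr (_ \Po _).
  by rewrite comp_polyD comp_polyX comp_polyC -addrA -polyCD addrC [_ * _ + _]addrC addrC.
(* The coefficient of y^i has x-order at least m - i, and w^b in (w + x e)^i carries x^(i - b):
   together at least m - b. *)
have [q Eq] : exists q, tau (F \Po ('X + g%:P))`_b = q * 'X^(m - b).
  apply/dvdXnP => a ha; rewrite -coef_map /= E1 comp_polyE coef_sum coef_sum.
  apply: big1 => -[i hi] _ /=; rewrite -mul_polyC coefCM coef_XaddC_exp.
  rewrite mulrnAr coefMn exprMn mulrA coefMXn.
  case: ltnP => ha2; first by rewrite mul0rn.
  case: (ltnP i b) => ib; first by rewrite bin_small.
  rewrite coefM big1 ?mul0rn // => -[j hj] _ /=; rewrite hF ?mul0r //.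
  move: ha ha2 hj ib; rewrite ltnS.
  by lia.
exists (q \Po ('X - x0%:P)).
rewrite -comp_Xn_poly -comp_polyM -Eq /tau -comp_polyA comp_polyD comp_polyX comp_polyC.
by rewrite subrK comp_polyXr.
Qed.
End Bivariate.

(** Each of the k factors forces the root a on q, because p does not vanish there. *)
Lemma dvd_XsubC_cancel (R : idomainType) (a : R) k p q s :
  p.[a] != 0 -> q * p = s * ('X - a%:P) ^+ k ->
  exists q', q = q' * ('X - a%:P) ^+ k.
Proof.
move=> pa; elim: k q s => [|k IHk] q s E; first by exists q; rewrite mulr1.
have : root q a.
  have /eqP := congr1 (horner^~ a) E; rewrite exprS !hornerM hornerXsubC subrr mul0r mulr0.
  by rewrite mulf_eq0 (negPf pa) orbF.
case/factor_theorem => q1 Eq; have [|q' Eq'] := IHk q1 s.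
  apply: (mulIf (negbT (polyXsubC_eq0 a))).
  by rewrite mulrAC -Eq E exprSr mulrA.
by exists q'; rewrite Eq Eq' exprSr mulrA.
Qed.

Lemma dvd_prod_XsubC (R : idomainType) (I : finType) (x : I -> R) k h :
  injective x -> (forall i, exists q, h = q * ('X - (x i)%:P) ^+ k) ->
  exists q, h = q * \prod_i ('X - (x i)%:P) ^+ k.
Proof.
move=> xI hI; have := index_enum_uniq I; elim: (index_enum I) => [|i r IHr] /=.
  by exists h; rewrite big_nil mulr1.
case/andP=> ir /IHr[q Eq]; have [s Es] := hI i.
have [||q' Eq'] := @dvd_XsubC_cancel R (x i) k (\prod_(j <- r) ('X - (x j)%:P) ^+ k) q s.
- rewrite horner_prod prodf_seq_neq0; apply/allP => j jr /=.
  rewrite horner_exp expf_neq0 // hornerXsubC subr_eq0.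
  by apply: contraNneq ir => /xI ->.
- by rewrite -Eq.
by exists q'; rewrite big_cons Eq {1}Eq' mulrA.
Qed.

Section Limit.
Variables (K : fieldType) (n m d r T : nat).
Hypothesis char0 : [pchar K] =i pred0.

(* The n points x = 1 + i e of the arc, as functions of e = 'X,
   all of which tend to x = 1. *)
Definition abscissa (i : 'I_n) : {poly K} := 1 + i%:R *: 'X.
Definition ordinate (i : 'I_n) : {poly K} := (map_poly polyC (arc K d r)).[abscissa i].
Definition arc_cond (y : tri T) (j : 'I_n * tri m) : {poly K} :=
  taylor (abscissa j.1) (ordinate j.1) (tri_x y) (tri_y y) (tri_x j.2) (tri_y j.2).

Lemma abscissa_inj : injective abscissa.
Proof.
move=> i j /(congr1 (coefp 1%N)) /=; rewrite !coefD !coefZ coefX eqxx !mulr1.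
by move=> /addrI/(natr_inj_pchar0 char0)/val_inj.
Qed.

(** Over K[e] the abscissas are distinct, so the coefficient of w^b is divisible by the product of
    the (x - x_i)^(m - b). At e = 0 this product becomes (x - 1)^(n (m - b)). *)
Lemma arc_order_limit u :
  (forall j, \sum_y u y * arc_cond y j = 0) ->
  arc_order n (n * m) (arc K d r) (bipoly (fun y => (u y).[0])).
Proof.
move=> hu b; pose g : {poly {poly K}} := map_poly polyC (arc K d r).
have [q Eq] : exists q, (bipoly u \Po ('X + g%:P))`_b =
    q * \prod_i ('X - (abscissa i)%:P) ^+ (m - b).
  apply: dvd_prod_XsubC abscissa_inj _ => i; apply: dvd_coef_arc => p c pc.
  have [x [Ex Ey]] := tri_ex pc.
  by rewrite coef_shift_bipoly -[RHS](hu (i, x)) /arc_cond /= Ex Ey.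
pose ev : {rmorphism {poly K} -> K} := horner_eval 0.
pose ev2 : {rmorphism {poly {poly K}} -> {poly K}} := map_poly ev.
have E : bipoly (fun y => (u y).[0]) \Po ('X + (arc K d r)%:P) =
    map_poly ev2 (bipoly u \Po ('X + g%:P)).
  rewrite map_comp_poly; congr (_ \Po _); last first.
    rewrite /bipoly rmorph_sum /=; apply: eq_bigr => y _ /=.
    by rewrite rmorphM /= map_polyC /= map_polyXn map_polyZ /= map_polyXn.
  rewrite [RHS]rmorphD /= map_polyX map_polyC /= /g -map_poly_comp.
  by rewrite (eq_map_poly (g := id)) ?map_poly_id // => c /=; rewrite /horner_eval hornerC.
have Ep : ev2 (\prod_i ('X - (abscissa i)%:P) ^+ (m - b)) =
    \prod_(i < n) ('X - 1%:P) ^+ (m - b).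
  rewrite rmorph_prod; apply: eq_bigr => i _.
  rewrite rmorphXn rmorphB /= map_polyX map_polyC /=.
  by rewrite /horner_eval /abscissa !hornerE.
have -> : (bipoly (fun y => (u y).[0]) \Po ('X + (arc K d r)%:P))`_b =
    ev2 q * \prod_(i < n) ('X - 1%:P) ^+ (m - b).
  by rewrite E -Ep -rmorphM -Eq; apply: coef_map.

by rewrite prodr_const card_ord -exprM -mulnBr mulnC dvdp_mull.
Qed.

Hypotheses (d_gt0 : (0 < d)%N) (r_le : (r <= n)%N)
  (few_terms : forall k b, (k * d < T)%N ->
    (term_count d (T - k * d) <= (n * m - k * r - n * b) + r * b)%N).

(** The limit u(0) is zero by the descent, so e divides u and u / e is again in the kernel; induct
    on a bound for the degrees in e. *)
Lemma arc_cond_ker u : (forall j, \sum_y u y * arc_cond y j = 0) -> forall y, u y = 0.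
Proof.
move=> hu y; have [N] : exists N, forall y, (size (u y) <= N)%N.
  by exists (\max_y size (u y))%N => z; apply: leq_bigmax.
elim: N => [|N IHN] in u hu * => hN.
  by apply/eqP; rewrite -size_poly_leq0.
have u0 z : (u z).[0] = 0.
  rewrite -(coef_bipoly (fun z => (u z).[0])).
  rewrite (arc_order_eq0 char0 d_gt0 r_le few_terms _ (arc_order_limit hu)) ?coef0 //.
  by move=> b; apply: size_bipoly.
pose v z := drop_poly 1 (u z).
have Ev z : u z = v z * 'X.
  rewrite -{1}[u z](poly_take_drop 1) expr1 /v.
  suff -> : take_poly 1 (u z) = 0 by rewrite add0r.
  apply/polyP=> -[|a]; rewrite coef_take_poly coef0 //=.
  by rewrite -horner_coef0.
rewrite Ev IHN ?mul0r // => [j|z]; last by rewrite size_drop_poly leq_subLR.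
apply: (mulIf (negbT (polyX_eq0 K))); rewrite mul0r mulr_suml -[RHS](hu j).
by apply: eq_bigr => z _; rewrite mulrAC -Ev.
Qed.
End Limit.

(** * The open set *)

Lemma ord3_case (P : 'I_3 -> Prop) : P 0 -> P 1 -> P ord_max -> forall i, P i.
Proof.
move=> P0 P1 P2 [[|[|[|//]]] hi].
- by rewrite (_ : Ordinal hi = 0) //; apply: val_inj.
- by rewrite (_ : Ordinal hi = 1) //; apply: val_inj.
- by rewrite (_ : Ordinal hi = ord_max) //; apply: val_inj.
Qed.

Lemma big_ord3 (V : Type) (idx : V) (op : Monoid.law idx) (f : 'I_3 -> V) :
  \big[op/idx]_i f i = op (f 0) (op (f 1) (f ord_max)).
Proof.
rewrite !big_ord_recl big_ord0 Monoid.mulm1.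
by congr (op (f _) (op (f _) (f _))); apply: val_inj.
Qed.

Section Chart.
Variable K : fieldType.

Lemma mcoeff_taylor (x0 y0 : K) a b (nu : 'X_{1..2}) :
  ((x0%:MP + 'X_0) ^+ a * (y0%:MP + 'X_1) ^+ b)@_nu =
  taylor x0 y0 a b (nu 0) (nu 1).
Proof.
pose q (c : K) k i : K := c ^+ (k - i) *+ 'C(k, i).
have E (c : K) (j : 'I_2) k : (c%:MP + 'X_j) ^+ k =
    \sum_(i < k.+1) q c k i *: 'X_[U_(j) *+ i] :> {mpoly K[2]}.
  rewrite exprDn; apply: eq_bigr => i _.
  by rewrite /q -mpolyXn -rmorphXn /= mul_mpolyC scalerMnl.
rewrite !E big_distrlr /= raddf_sum /=.
have C (i j : nat) : (q x0 a i *: 'X_[U_(0%R) *+ i] * (q y0 b j *: 'X_[U_(1%R) *+ j]))@_nu =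
    (if i == nu 0 then q x0 a i else 0) * (if j == nu 1 then q y0 b j else 0).
  rewrite -scalerAl -scalerAr scalerA -mpolyXD mcoeffZ mcoeffX.
  have -> : ((U_(0%R) *+ i + U_(1%R) *+ j)%MM == nu) = (i == nu 0) && (j == nu 1).
    apply/eqP/andP => [<-|[/eqP Ei /eqP Ej]].
      by rewrite !mnmDE !mulmnE !mnm1E /= !mul1n !mul0n addn0 add0n !eqxx.
    apply/mnmP => k; rewrite mnmDE !mulmnE !mnm1E Ei Ej.
    by case: k => [[|[|//]] hk]; rewrite /= ?mul0n ?mul1n ?addn0 ?add0n; congr (nu _); apply: val_inj.
  by case: eqP => _; case: eqP => _ /=; rewrite ?mulr1 ?mulr0 ?mul0r.
have S (c : K) k e : \sum_(i < k.+1) (if i == e :> nat then q c k i else 0) = q c k e.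
  case: (ltnP e k.+1) => he.
    rewrite (bigD1 (Ordinal he)) //= eqxx big1 ?addr0 // => i ne.
    by case: eqP => // Ei; case/eqP: ne; apply: val_inj.
  rewrite /q bin_small // mulr0n big1 // => i _.
  by case: eqP => // Ei; rewrite bin_small // Ei.
rewrite (eq_bigr (fun i : 'I_a.+1 =>
    (if i == nu 0 :> nat then q x0 a i else 0) * q y0 b (nu 1))); last first.
  move=> i _; rewrite raddf_sum /= -(S y0) mulr_sumr.
  by apply: eq_bigr => j _; exact: C.
by rewrite -mulr_suml S.
Qed.

(* The monomial of degree T - 1 that becomes x^(tri_x y) y^(tri_y y) in the chart
   x_0 = 1. *)
Definition homog_mnm T (y : tri T) : 'X_{1..3} :=
  [multinom nth 0%N [:: T.-1 - (tri_x y + tri_y y); tri_x y; tri_y y]%N i | i < 3].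

Lemma homog_decomp T (F : {mpoly K[3]}) : (0 < T)%N -> F \is T.-1.-homog ->
  F = \sum_(y : tri T) F@_(homog_mnm y) *: 'X_[homog_mnm y].
Proof.
move=> T0 hF; apply/mpolyP => mu; rewrite raddf_sum /=.
have hinj (y z : tri T) : homog_mnm y = homog_mnm z -> y = z.
  move=> /mnmP E; apply: tri_inj; first by have := E 1; rewrite !mnmE.
  by have := E ord_max; rewrite !mnmE.
have [z|nz] := eqVneq F@_mu 0.
  rewrite z big1 // => y _; rewrite mcoeffZ mcoeffX.
  by case: eqP => [->|_]; rewrite ?z ?mul0r ?mulr0.
have : mdeg mu = T.-1 by have /dhomogP/(_ mu) := hF; rewrite mcoeff_msupp => /(_ nz).
rewrite mdegE big_ord3 => Emu.
have [y [Ex Ey]] : exists y : tri T, tri_x y = mu 1 /\ tri_y y = mu ord_max.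
  by apply: tri_ex; rewrite -(prednK T0) ltnS -Emu leq_addl.
have Ehm : homog_mnm y = mu.
  apply/mnmP; apply: ord3_case; rewrite mnmE Ex Ey //=.
  by rewrite -Emu addnK.
rewrite (bigD1 y) //= mcoeffZ mcoeffX Ehm eqxx mulr1 big1 ?addr0 // => z ne.
rewrite mcoeffZ mcoeffX -Ehm; case: eqP => [/hinj E|]; last by rewrite mulr0.
by rewrite E eqxx in ne.
Qed.

Lemma mcoeff_local_eq T (F : {mpoly K[3]}) (v : 'rV[K]_3) nu :
  (0 < T)%N -> F \is T.-1.-homog ->
  (local_eq F v 0)@_nu = \sum_(y : tri T) F@_(homog_mnm y) *
    (v 0 0 ^+ (T.-1 - (tri_x y + tri_y y)) *
     taylor (v 0 1) (v 0 ord_max) (tri_x y) (tri_y y) (nu 0) (nu 1)).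
Proof.
move=> T0 hF; rewrite {1}(homog_decomp T0 hF) /local_eq rmorph_sum /= raddf_sum /=.
apply: eq_bigr => y _; rewrite comp_mpolyZ mcoeffZ; congr (_ * _).
rewrite comp_mpolyX big_ord3 /= !tnth_mktuple !mnmE /=.
have -> : unlift (0 : 'I_3) 0 = None by apply: unlift_none.
have -> : unlift (0 : 'I_3) 1 = Some (0 : 'I_2).
  by rewrite (_ : 1 = lift 0 0) ?liftK //; apply: val_inj.
have -> : unlift (0 : 'I_3) ord_max = Some (1 : 'I_2).
  by rewrite (_ : ord_max = lift 0 1) ?liftK //; apply: val_inj.
by rewrite /= addr0 -rmorphXn /= mcoeffCM mcoeff_taylor.
Qed.


Lemma fat_ideal_order n (P : 'M[K]_(n, 3)) m F i :
  fat_ideal P m F -> P i 0 != 0 -> order_ge m (local_eq F (row i P) 0).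
Proof.
move=> [s [hs ->]] Pi0; rewrite /local_eq rmorph_sum /=.
have : {subset s <= s} by [].
elim: {1 3}s => [|x r IHr] hr; first by rewrite big_nil => mu _; rewrite mcoeff0.
rewrite big_cons => mu hmu; rewrite mcoeffD IHr ?addr0 //; last first.
  by move=> y yr; apply: hr; rewrite inE yr orbT.
rewrite rmorphM /=; apply: (@order_geM _ 0 m) hmu => //.
by apply: (hs x _).2 => //; [apply: hr; rewrite mem_head|rewrite mxE].
Qed.

Definition point_var n (i : 'I_n) (j : 'I_3) : {mpoly K[n * 3]} := 'X_(mxvec_index i j).

(** The conditions at indeterminate points; they specialize to [arc_cond] when x_0 = 1 and the
    points lie on the arc. *)
Definition chart_cond n m T (y : tri T) (j : 'I_n * tri m) : {mpoly K[n * 3]} :=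
  point_var j.1 0 ^+ (T.-1 - (tri_x y + tri_y y)) *
  taylor (point_var j.1 1) (point_var j.1 ord_max) (tri_x y) (tri_y y) (tri_x j.2) (tri_y j.2).

Lemma eval_point_var n (i : 'I_n) j P : eval_at (point_var i j) P = P i j.
Proof. by rewrite /eval_at mevalXU mxvecE. Qed.

Lemma eval_chart_cond n m T P y j : eval_at (@chart_cond n m T y j) P =
  P j.1 0 ^+ (T.-1 - (tri_x y + tri_y y)) *
  taylor (P j.1 1) (P j.1 ord_max) (tri_x y) (tri_y y) (tri_x j.2) (tri_y j.2).
Proof.
rewrite /eval_at /chart_cond mevalM rmorphXn rmorph_taylor /=.
by rewrite -!/(eval_at _ P) !eval_point_var.
Qed.

Lemma rmorph_minor (R S : idomainType) (f : {rmorphism R -> S}) (I J : finType)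
  (A : I -> J -> R) h : f (minor A h) = minor (fun i j => f (A i j)) h.
Proof.
by rewrite /minor -det_map_mx; congr (\det _); apply/matrixP=> k l; rewrite !mxE.
Qed.

(** Multiplying by a power of x_0 raises every form to degree T - 1, so one minor excludes all
    degrees below T. *)
Lemma minor_no_component n (P : 'M[K]_(n, 3)) m T h t :
  (forall i, P i 0 != 0) -> eval_at (minor (@chart_cond n m T) h) P != 0 ->
  (t < T)%N -> ~ fat_component_neq0 P m t.
Proof.
move=> P0 hP tT [F [hF hI /eqP]]; apply.
pose G := F * 'X_0 ^+ (T.-1 - t).
have T0 : (0 < T)%N by case: (T) tT.
have hG : G \is T.-1.-homog.
  have -> : T.-1 = (t + 1 * (T.-1 - t))%N by rewrite mul1n subnKC // -ltnS prednK.
  by apply: dhomogM => //; apply: dhomogMn; rewrite dhomogX; apply/eqP; exact: mdeg1.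
suff G0 : G = 0.
  have X0 : 'X_0 != 0 :> {mpoly K[3]} by rewrite -msupp_eq0 msuppX.
  by apply/eqP; move/eqP: G0; rewrite mulf_eq0 expf_eq0 (negPf X0) andbF orbF.
rewrite (homog_decomp T0 hG) big1 // => y _.
rewrite [X in X *: _](_ : _ = 0) ?scale0r //; move: y.
apply: (@minor_neq0_ker _ _ _ (fun y j => eval_at (@chart_cond n m T y j) P) h).
  by rewrite -rmorph_minor.
move=> [i x]; have [nu [nu0 nu1]] : exists nu : 'X_{1..2}, nu 0 = tri_x x /\ nu 1 = tri_y x.
  by exists [multinom nth 0%N [:: tri_x x; tri_y x] k | k < 2]; rewrite !mnmE.
have hnu : (mdeg nu < m)%N.
  rewrite mdegE !big_ord_recl big_ord0 addn0 nu0.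
  by rewrite (_ : lift ord0 ord0 = 1) ?nu1 ?tri_lt //; apply: val_inj.
have : (local_eq G (row i P) 0)@_nu = 0.
  rewrite /local_eq rmorphM /= mulrC.
  apply: (@order_geM _ 0 m) hnu => //; exact: fat_ideal_order hI _.
rewrite (mcoeff_local_eq _ _ T0 hG) => E; rewrite -[RHS]E.
by apply: eq_bigr => y _; rewrite eval_chart_cond !mxE nu0 nu1.
Qed.

End Chart.

(** * Multihomogeneity of the minors *)

Lemma eq_mxvec_index m n (i k : 'I_m) (j l : 'I_n) :
  (mxvec_index i j == mxvec_index k l) = (i == k) && (j == l).
Proof.
by rewrite /mxvec_index (inj_eq (@cast_ord_inj _ _ _)) (inj_eq enum_rank_inj) xpair_eqE.
Qed.

Section Multidegree.
Variables (K : fieldType) (n : nat).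
Implicit Types (f g : {mpoly K[n * 3]}) (e : 'I_n -> nat).

Definition multideg e f := forall mu : 'X_{1..n * 3}, mu \in msupp f ->
  forall i : 'I_n, (\sum_(j < 3) mu (mxvec_index i j))%N = e i.

Lemma multideg0 e : multideg e 0.
Proof. by move=> mu; rewrite msupp0. Qed.

Lemma multideg1 : multideg (fun=> 0%N) 1.
Proof.
move=> mu; rewrite msupp1 inE => /eqP -> i.
by rewrite big1 // => j _; rewrite mnm0E.
Qed.

Lemma multidegD e f g : multideg e f -> multideg e g -> multideg e (f + g).
Proof.
move=> hf hg mu /msuppD_le; rewrite mem_cat => /orP[]; [exact: hf|exact: hg].
Qed.

Lemma multideg_sum e (I : Type) (r : seq I) (P : pred I) F :
  (forall i, P i -> multideg e (F i)) -> multideg e (\sum_(i <- r | P i) F i).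
Proof. by move=> h; elim/big_ind: _ => //; [exact: multideg0|exact: multidegD]. Qed.

Lemma multidegM e1 e2 f g : multideg e1 f -> multideg e2 g ->
  multideg (fun i => e1 i + e2 i)%N (f * g).
Proof.
move=> hf hg mu /msuppM_le /allpairsP[[m1 m2] /= [/hf h1 /hg h2 ->]] i.
by rewrite -h1 -h2 -big_split; apply: eq_bigr => j _; rewrite mnmDE.
Qed.

Lemma multideg_prod (I : Type) (r : seq I) (e : I -> 'I_n -> nat) F :
  (forall i, multideg (e i) (F i)) ->
  multideg (fun k => \sum_(i <- r) e i k)%N (\prod_(i <- r) F i).
Proof.
move=> h; elim: r => [|i r IHr].
  by rewrite big_nil => mu hmu k; rewrite big_nil; exact: multideg1.
rewrite big_cons => mu hmu k; rewrite big_cons.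
exact: (multidegM (h i) IHr).
Qed.

Lemma multidegX e f k : multideg e f -> multideg (fun i => k * e i)%N (f ^+ k).
Proof.
move=> hf; elim: k => [|k IHk]; first exact: multideg1.
by rewrite exprS => mu hmu i; rewrite mulSn; exact: (multidegM hf IHk).
Qed.

Lemma multideg_sign e f (b : bool) : multideg e f -> multideg e ((-1) ^+ b * f).
Proof.
case: b => hf; last by rewrite expr0 mul1r.
by rewrite expr1 mulN1r => mu; rewrite (perm_mem (msuppN f)); exact: hf.
Qed.

Lemma multidegMn e f k : multideg e f -> multideg e (f *+ k).
Proof.
by move=> hf; elim: k => [|k IHk]; [exact: multideg0|rewrite mulrS; exact: multidegD].
Qed.

Lemma multideg_point_var i j : multideg (fun k => (k == i : nat)) (point_var K i j).
Proof.
move=> mu; rewrite /point_var msuppX inE => /eqP -> k.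
under eq_bigr do rewrite mnm1E eq_mxvec_index [i == k]eq_sym.
case: eqP => _ /=; last by rewrite big1.
by rewrite (bigD1 j) //= eqxx big1 // => l /negPf; rewrite eq_sym => ->.
Qed.

(** The multidegree depends on the column j only, not on the row y, so all terms of a minor share
    one multidegree. *)
Lemma multideg_chart_cond m T (y : tri T) (j : 'I_n * tri m) :
  multideg (fun k => (k == j.1) * (T.-1 - (tri_x j.2 + tri_y j.2)))%N (chart_cond K y j).
Proof.
case: j => i x /=; rewrite /chart_cond /taylor /=.
(* Where an exponent difference would be truncated, the binomial makes the entry zero. *)
case: (ltnP (tri_x y) (tri_x x)) => hx; first by rewrite bin_small // mul0r mulr0; exact: multideg0.
case: (ltnP (tri_y y) (tri_y x)) => hy; first by rewrite (bin_small hy) mulr0 mulr0; exact: multideg0.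
have X a l := @multidegX _ _ a (@multideg_point_var i l).
have H := multidegM (X (T.-1 - (tri_x y + tri_y y))%N 0)
  (multidegM (@multidegMn _ _ 'C(tri_x y, tri_x x) (X (tri_x y - tri_x x)%N 1))
             (@multidegMn _ _ 'C(tri_y y, tri_y x) (X (tri_y y - tri_y x)%N ord_max))).
move=> mu hmu k; rewrite (H mu hmu k) -!mulnDl mulnC; congr (_ * _)%N.
by have := tri_lt y; lia.
Qed.

Lemma multihomog_minor m T h : multihomog (minor (@chart_cond K n m T) h).
Proof.
exists (fun k => \sum_l (k == (h l).1) * (T.-1 - (tri_x (h l).2 + tri_y (h l).2)))%N.
(* After transposition each product runs over the columns. *)
rewrite /minor -det_tr /determinant; apply: multideg_sum => s _.
apply: multideg_sign.
apply: (@multideg_prod _ _ (fun l k => (k == (h l).1) * (T.-1 - (tri_x (h l).2 + tri_y (h l).2)))%N).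
by move=> l; rewrite !mxE; apply: multideg_chart_cond.
Qed.
End Multidegree.

(** * Nonemptiness of the open set and the conclusion *)

Lemma exists_nonroot (K : fieldType) (p : {poly K}) :
  [pchar K] =i pred0 -> p != 0 -> exists c, p.[c] != 0.
Proof.
move=> char0 p0; apply: contrapT => h.
have hr c : root p c by rewrite rootE; apply: contrapT => /negP hc; apply: h; exists c.
have := max_poly_roots (rs := [seq i%:R | i <- iota 0 (size p)]) p0.
rewrite size_map size_iota ltnn => H; suff : false by []; apply: H.
  by apply/allP => c _.
by rewrite map_inj_uniq ?iota_uniq //; exact: natr_inj_pchar0.
Qed.

Lemma general_no_component (K : fieldType) n m d r T :
  [pchar K] =i pred0 -> (0 < d)%N -> (r <= n)%N ->
  (forall k b, (k * d < T)%N ->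
    (term_count d (T - k * d) <= (n * m - k * r - n * b) + r * b)%N) ->
  general_points (fun P : 'M[K]_(n, 3) =>
    forall t, (t < T)%N -> ~ fat_component_neq0 P m t).
Proof.
move=> char0 d0 rn few_terms.
have [h hh] := exists_minor_neq0 (@arc_cond_ker K n m d r T char0 d0 rn few_terms).
pose D : {mpoly K[n * 3]} := minor (@chart_cond K n m T) h.
(* The second factor keeps all points in the chart x_0 != 0. *)
pose f : {mpoly K[n * 3]} := D * \prod_i point_var K i 0.
have fE P : eval_at f P = eval_at D P * \prod_i P i 0.
  rewrite /eval_at /f mevalM rmorph_prod /=; congr (_ * _).
  by apply: eq_bigr => i _; exact: eval_point_var.
exists (fun P => point_tuple P /\ eval_at f P != 0); split.
- exists (eq f); split=> [g <-|P].
    have [e he] := @multihomog_minor K n m T h.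
    by eexists; apply: (multidegM he); apply: multideg_prod => i; exact: multideg_point_var.
  split=> -[hP]; first by move=> hf; split => //; exists f.
  by case=> g [<- hf].
- have [c hc] := exists_nonroot char0 hh.
  (* The arc points at e = c, where the minor of [arc_cond] is nonzero. *)
  pose P : 'M[K]_(n, 3) := \matrix_(i, j)
    nth 0 [:: 1; (abscissa K i).[c]; (ordinate K d r i).[c]] j.
  have P0 i : P i 0 = 1 by rewrite mxE.
  exists P; split.
    by move=> i; apply/rV0Pn; exists 0; rewrite mxE P0 oner_eq0.
  rewrite fE mulf_neq0 //; last by apply/prodf_neq0 => i _; rewrite P0 oner_eq0.
  suff -> : eval_at D P = (minor (@arc_cond K n m d r T) h).[c] by [].
  transitivity (minor (fun y j => eval_at (chart_cond K y j) P) h).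
    exact: rmorph_minor.
  transitivity (minor (fun y j => (arc_cond K d r y j).[c]) h); last first.
    by apply/esym; exact: (rmorph_minor (horner_eval c)).
  rewrite /minor; congr (\det _); apply/matrixP => k l.
  rewrite [LHS]mxE [RHS]mxE eval_chart_cond P0 expr1n mul1r.
  rewrite -[RHS]/(horner_eval c _) /arc_cond rmorph_taylor.
  by rewrite ![P _ _]mxE.
move=> P [hP]; rewrite fE mulf_eq0 negb_or => /andP[hD /prodf_neq0 h0] t tT.
by apply: (minor_no_component (fun i => h0 i isT) hD tT).
Qed.

Lemma floor_sqrt_nat (R : realType) (n d : nat) :
  d%:Z = Num.floor (Num.sqrt (n%:R : R)) -> (d * d <= n < d.+1 * d.+1)%N.
Proof.
move=> h; have hs := sqrtr_ge0 (n%:R : R).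
have := floor_itv (Num.sqrt (n%:R : R)).
rewrite -h intrD -pmulrn natr1 => /andP[h1 h2].
have hn : n%:R = Num.sqrt (n%:R : R) * Num.sqrt n%:R by rewrite -expr2 sqr_sqrtr.
rewrite -(ler_nat R) -(ltr_nat R) !natrM hn.
by rewrite ler_pM //= ltr_pM.
Qed.

Lemma lt_mul_sqrt_nat (R : realType) (t m n : nat) :
  ((t%:R : R) < m%:R * Num.sqrt n%:R) = (t * t < m * m * n)%N.
Proof.
rewrite -(ltr_nat R) !natrM -!expr2 -[X in _ = (_ < _ * X)](@sqr_sqrtr R) //.
by rewrite -exprMn ltr_pXn2r // nnegrE ?mulr_ge0 ?sqrtr_ge0.
Qed.

Theorem mainTheorem3 (R : realType) (n m d Delta : nat)
    (n_gt9 : (9 < n)%N)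
    (d_def : d%:Z = Num.floor (Num.sqrt (n%:R : R)))
    (Delta_def : Delta%:Z = n%:Z - d%:Z ^+ 2)
    (hm : (odd Delta /\
            m%:R <= Num.max (d%:R * (d%:R - 3%:R))
                            (d%:R * (d%:R - 2%:R) / Delta%:R) :> R)
       \/ ((0 < Delta)%N /\ ~~ odd Delta /\
            m%:R <= Num.max (d%:R * (d%:R - 3%:R) / 2%:R)
                            (2%:R * d%:R ^+ 2 / Delta%:R) :> R)) :
  general_points (fun P : 'M[R[i]]_(n, 3) =>
    m%:R * Num.sqrt (n%:R : R) <= (alpha P m)%:R).
Proof.
have /andP[dn nd] := floor_sqrt_nat d_def.
have d3 : (3 <= d)%N by rewrite leqNgt; apply/negP => d2; have := leq_mul d2 d2; lia.
have En : n = (d * d + Delta)%N by lia.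
have natB k : (k <= 3)%N -> d%:R - k%:R = (d - k)%:R :> R.
  by move=> k3; rewrite natrB // (leq_trans k3).
have divD a : (0 < Delta)%N -> (m%:R <= a%:R / Delta%:R :> R) = (m * Delta <= a)%N.
  by move=> D0; rewrite ler_pdivlMr ?ltr0n // -natrM ler_nat.
have {}hm : (odd Delta /\ (m <= d * (d - 3) \/ m * Delta <= d * (d - 2)))%N \/
  (0 < Delta /\ ~~ odd Delta /\ (2 * m <= d * (d - 3) \/ m * Delta <= 2 * (d * d)))%N.
  case: hm => [[oD]|[D0 [eD]]]; rewrite le_max !natB // -!natrM.
    rewrite ler_nat divD ?odd_gt0 // => /orP h; left; split=> //.
  rewrite -natrX -natrM divD // ler_pdivlMr ?ltr0n // -natrM ler_nat mulnC => /orP h.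
  by right.
(* T is m sqrt n rounded up. *)
have [T hT] : exists T, forall t, (t < T)%N = (t * t < m * m * n)%N.
  have ex : exists T, (m * m * n <= T * T)%N.
    by exists (m * n)%N; rewrite mulnACA leq_mul2l leq_pmulr ?orbT //; lia.
  exists (ex_minn ex) => t; case: ex_minnP => T h1 h2.
  apply/idP/idP => [tT|h]; first by rewrite ltnNge; apply/negP => /h2; rewrite leqNgt tT.
  by rewrite ltnNge; apply/negP => Tt; have := leq_mul Tt Tt; lia.
have [r rn few_terms] : exists2 r, (r <= n)%N & forall k b, (k * d < T)%N ->
    (term_count d (T - k * d) <= (n * m - k * r - n * b) + r * b)%N.
  (* For T = 0 nothing is asked; otherwise t = T - 1 is the largest degree below m sqrt n. *)
  case: T hT => [|t] hT; first by exists 0%N.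
  by apply: (exists_contact_order n_gt9 dn nd En hm); rewrite -hT.
have d0 : (0 < d)%N by lia.
have [U [Uopen Uex hU]] := general_no_component (@pchar_num R[i]) d0 rn few_terms.
exists U; split=> // P /hU noP.
rewrite leNgt lt_mul_sqrt_nat -hT; apply/negP => aT.
apply: (noP _ aT); rewrite /alpha; case: ex_minnP => t /asboolP h _; exact: h.
Qed.
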